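(* Let $k$ be fixed and $\rho\in[0,1]$. For $k$CP (respectively $k$PP), given a polynomial-time $\rho$-approximation algorithm on $\{0,1\}$-weighted graphs, one can obtain a polynomial-time $(1+\rho)/2$-approximation algorithm on $\{1,2\}$-weighted graphs.
   Context: A $\{0,1\}$-weighted (resp. $\{1,2\}$-weighted) graph is an undirected complete graph on $n$ vertices in which every edge has weight in $\{0,1\}$ (resp. $\{1,2\}$); the weight of a set of edges is the sum of their weights. A $k$-cycle (resp. $k$-path) is a simple cycle (resp. path) on exactly $k$ distinct vertices. When $k$ divides $n$, a $k$-cycle packing (resp. $k$-path packing) is a set of $n/k$ vertex-disjoint $k$-cycles (resp. $k$-paths) covering all vertices. $k$CP (resp. $k$PP): given such a graph with $n$ divisible by $k$, find a $k$-cycle packing (resp. $k$-path packing) of maximum total weight. A $\rho$-approximation algorithm outputs on every instance a feasible solution of weight at least $\rho$ times the optimum. *)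

(* Defs.v *)
From HB Require Import structures.
From mathcomp Require Import all_boot all_order all_algebra.
From mathcomp Require Import reals.
Set Implicit Arguments.
Unset Strict Implicit.
Unset Printing Implicit Defensive.
Import Order.TTheory GRing.Theory Num.Theory.

(** * Weighted complete graphs and packings *)

(* The edges of the complete graph on 'I_n are the two-element sets of
   vertices; the value of a weighting on any other set is never used. *)
Definition weighting (n : nat) : Type := {set 'I_n} -> nat.

Definition weighted_in (W : seq nat) n (w : weighting n) : Prop :=
  forall e : {set 'I_n}, #|e| = 2 -> w e \in W.

Definition weight n (w : weighting n) (E : {set {set 'I_n}}) : nat :=
  \sum_(e in E) w e.

Inductive problem := CyclePacking | PathPacking.

Definition pair_edges n (s : seq ('I_n * 'I_n)) : {set {set 'I_n}} :=
  [set [set p.1; p.2] | p in s].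

(* Edges of the cycle (resp. path) that visits the vertices of [c] in order. *)
Definition edges_of (pb : problem) n (c : seq 'I_n) : {set {set 'I_n}} :=
  match pb with
  | CyclePacking => pair_edges (zip c (rot 1 c))
  | PathPacking => pair_edges (zip c (behead c))
  end.

(* A candidate solution lists n / k blocks of k vertices, each block listing
   the vertices of a cycle or path in order. *)
Definition candidate (k n : nat) := (n %/ k).-tuple (k.-tuple 'I_n).

Definition vertices k n (P : candidate k n) : seq 'I_n :=
  flatten [seq tval c | c <- P].

(* [uniq] says both that every block has k distinct vertices and that
   different blocks are vertex-disjoint. *)
Definition is_packing k n (P : candidate k n) : bool :=
  uniq (vertices P) && [forall v, v \in vertices P].

Definition packing_edges (pb : problem) k n (P : candidate k n) :
    {set {set 'I_n}} :=
  \bigcup_(c <- P) edges_of pb c.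

Definition packing_weight (pb : problem) k n (w : weighting n)
    (P : candidate k n) : nat :=
  weight w (packing_edges pb P).

Definition opt (pb : problem) k n (w : weighting n) : nat :=
  \max_(P : candidate k n | is_packing P) packing_weight pb w P.

(** * Deterministic single-tape Turing machines *)

Inductive symbol := D0 | D1 | D2 | Sep.

Inductive move := MoveL | Stay | MoveR.

Definition shift (m : move) : int :=
  match m with MoveL => (-1)%R | Stay => 0%R | MoveR => 1%R end.

(* Tape symbols: [None] is the blank, [Some (inl s)] an input/output symbol,
   [Some (inr a)] an auxiliary symbol of the machine. *)
Record machine := Machine {
  state : finType;
  aux : finType;
  start : state;
  (* [None] means that the machine halts. *)
  delta : state -> option (symbol + aux) ->
          option (state * option (symbol + aux) * move)
}.

Definition cell (M : machine) : Type := option (symbol + aux M).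

Record config (M : machine) := Config {
  cstate : state M;
  tape : int -> cell M;
  head_pos : int
}.

Definition action M (c : config M) : option (state M * cell M * move) :=
  delta (cstate c) (tape c (head_pos c)).

Definition step M (c : config M) : config M :=
  match action c with
  | None => c
  | Some (q, a, m) =>
      Config q (fun z => if z == head_pos c then a else tape c z)
             (head_pos c + shift m)%R
  end.

Definition word_cell M (x : seq symbol) (i : nat) : cell M :=
  omap inl (onth x i).

Definition init M (x : seq symbol) : config M :=
  Config (start M)
         (fun z => match z with Posz i => word_cell M x i | Negz _ => None end)
         0%R.

(* The word on the tape from the head position up to the first blank is y. *)
Definition reads M (c : config M) (y : seq symbol) : Prop :=
  forall i : nat, i <= size y ->
    tape c (head_pos c + i%:Z)%R = word_cell M y i.

(* Since [step] fixes halted configurations, this says that M halts on x after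
   at most t steps, with output y. *)
Definition outputs_within M (x : seq symbol) (t : nat) (y : seq symbol) : Prop :=
  let c := iter t (@step M) (init M x) in action c = None /\ reads c y.

(** * Encodings and approximation algorithms *)

(* Only weights 0, 1 and 2 ever occur. *)
Definition digit (m : nat) : symbol :=
  match m with 0 => D0 | 1 => D1 | _ => D2 end.

(* The n x n weight matrix (with zero diagonal), row by row. *)
Definition encode_graph n (w : weighting n) : seq symbol :=
  flatten
    [seq rcons [seq digit (if u == v then 0 else w [set u; v])
                   | v <- enum 'I_n] Sep
        | u <- enum 'I_n].

(* The vertices block after block, each in unary; as k is fixed this determines
   the blocks, and as a graph encoding has length at least n ^ 2 the unary
   notation is of polynomial length. *)
Definition encode_packing k n (P : candidate k n) : seq symbol :=
  flatten [seq rcons (nseq (val v) D1) Sep | v <- vertices P].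

Definition polytime_approx (R : realType) (pb : problem) (k : nat)
    (W : seq nat) (rho : R) (M : machine) : Prop :=
  exists p : {poly nat},
    forall (n : nat) (w : weighting n),
      k %| n -> weighted_in W w ->
      exists P : candidate k n,
        [/\ outputs_within M (encode_graph w)
              (p.[size (encode_graph w)])%R (encode_packing P),
            is_packing P
          & (rho * (opt pb k w)%:R <= (packing_weight pb w P)%:R)%R].

(* Main.v *)
Require Import Defs.
From HB Require Import structures.
From mathcomp Require Import all_boot all_order all_algebra.
From mathcomp Require Import reals.
From mathcomp Require Import zify lra.
Import Order.TTheory GRing.Theory Num.Theory.

(** Lower every weight of a {1,2}-weighted graph by one and run the given
    algorithm.  All packings have the same number m of edges, so the shift
    lowers the weight of every packing by m; as the shifted optimum o is at most
    m, rho * o + m >= (1 + rho) / 2 * (o + m).  On encodings the shift replaces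
    each symbol separately (a zero of the encoding lies on the diagonal and stays
    zero), so a single sweep over the input before the given algorithm starts
    suffices. *)

Set Implicit Arguments.
Unset Strict Implicit.
Unset Printing Implicit Defensive.

(** * Number of edges of a packing *)

Lemma pair_edges_cons n (p : 'I_n * 'I_n) s :
  pair_edges (p :: s) = [set p.1; p.2] |: pair_edges s.
Proof.
apply/setP=> e; rewrite in_setU1; apply/imsetP/orP.
  case=> q; rewrite inE => /orP[/eqP-> ->|qs ->]; first by left.
  by right; apply/imsetP; exists q.
case=> [/eqP->|/imsetP[q qs ->]]; first by exists p; rewrite ?inE ?eqxx.
by exists q; rewrite // inE qs orbT.
Qed.

Lemma pair_edges_rcons n (p : 'I_n * 'I_n) s :
  pair_edges (rcons s p) = [set p.1; p.2] |: pair_edges s.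
Proof.
rewrite -pair_edges_cons; apply/setP=> e.
by apply/imsetP/imsetP=> -[q qs ->]; exists q; rewrite // ?mem_rcons // -mem_rcons.
Qed.

Lemma path_edges_cons2 n (x y : 'I_n) s :
  edges_of PathPacking (x :: y :: s) =
  [set x; y] |: edges_of PathPacking (y :: s).
Proof. exact: pair_edges_cons. Qed.

Lemma path_edges1 n (x : 'I_n) : edges_of PathPacking [:: x] = set0.
Proof. by apply/setP=> e; rewrite inE; apply/imsetP=> -[]. Qed.

Lemma zip_rcons_last (T : Type) (x y : T) s :
  zip (x :: s) (rcons s y) = rcons (zip (x :: s) s) (last x s, y).
Proof. by elim: s x => //= z s IHs x; rewrite IHs. Qed.

Lemma cycle_edges_cons n (x : 'I_n) s :
  edges_of CyclePacking (x :: s) =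
  [set last x s; x] |: edges_of PathPacking (x :: s).
Proof. by rewrite /edges_of rot1_cons zip_rcons_last pair_edges_rcons. Qed.

Lemma path_edgesP n (c : seq 'I_n) e : uniq c ->
  e \in edges_of PathPacking c -> #|e| = 2 /\ {subset e <= c}.
Proof.
case: c => [|x s] => [_ /imsetP[] //|].
elim: s x => [|y s IHs] x; first by rewrite path_edges1 inE.
rewrite cons_uniq => /andP[xys uys]; rewrite path_edges_cons2 in_setU1 => /orP[/eqP->|].
  split; first by rewrite cards2; case: eqP xys => // ->; rewrite inE eqxx.
  by move=> z; rewrite !inE => /orP[]/eqP->; rewrite eqxx ?orbT.
case/IHs=> // e2 sub; split=> // z /sub zys; by rewrite inE zys orbT.
Qed.

Lemma edges_ofP pb n (c : seq 'I_n) e : (pb = CyclePacking -> 3 <= size c) ->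
  uniq c -> e \in edges_of pb c -> #|e| = 2 /\ {subset e <= c}.
Proof.
case: pb => [/(_ erefl)|_]; last exact: path_edgesP.
case: c => // x s sz us; rewrite cycle_edges_cons in_setU1.
case/orP=> [/eqP->|]; last exact: path_edgesP.
split; last by move=> z /set2P[]->; rewrite ?mem_last ?mem_head.
rewrite cards2; case: s sz us => //= y s _ /andP[xys _].
by case: eqP xys => // <-; rewrite mem_last.
Qed.

Definition edge_count (pb : problem) (k : nat) : nat :=
  match pb with CyclePacking => k | PathPacking => k.-1 end.

Lemma card_path_edges n (c : seq 'I_n) : uniq c ->
  #|edges_of PathPacking c| = (size c).-1.
Proof.
case: c => [_|x s]; first by apply/eqP; rewrite cards_eq0 -subset0; apply/subsetP=> e /imsetP[].
elim: s x => [|y s IHs] x; first by rewrite path_edges1 cards0.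
rewrite cons_uniq => /andP[xys uys]; rewrite path_edges_cons2 cardsU1 IHs //.
case: (boolP (_ \in _)) => // /(path_edgesP uys)[_ /(_ x)].
by rewrite !inE eqxx -in_cons (negPf xys) => /(_ isT).
Qed.

Lemma card_edges_of pb n (c : seq 'I_n) : (pb = CyclePacking -> 3 <= size c) ->
  uniq c -> #|edges_of pb c| = edge_count pb (size c).
Proof.
case: pb => [/(_ erefl)|_]; last exact: card_path_edges.
case: c => // x [|y [|z s]] // _ uc.
rewrite cycle_edges_cons cardsU1 card_path_edges //.
move: uc; rewrite cons_uniq => /andP[xyzs uyzs].
have := uyzs; rewrite cons_uniq => /andP[yzs _].
(* The closing edge is new: it differs from the first path edge because its end [l] lies beyond [y],
   and from the later ones because they avoid [x]. A cycle on two vertices would repeat its only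
   edge. *)
rewrite path_edges_cons2 in_setU1; set l := last _ _.
have lzs : l \in z :: s by exact: (mem_last z s).
case: eqP => [/setP/(_ l)|_].
  rewrite !inE eqxx /= => /esym/orP[]/eqP el; last by rewrite -el lzs in yzs.
  by rewrite -el inE lzs orbT in xyzs.
case: (boolP (_ \in _)) => // /(path_edgesP uyzs)[_ /(_ x)].
by rewrite !inE eqxx orbT -!in_cons (negPf xyzs) => /(_ isT).
Qed.

(** An edge is a nonempty subset of its block, so vertex-disjoint blocks have disjoint edge sets and
    the counts add up. *)
Lemma card_blocks_edges pb k n (cs : seq (k.-tuple 'I_n)) :
  (pb = CyclePacking -> 3 <= k) -> uniq (flatten [seq tval c | c <- cs]) ->
  #|\bigcup_(c <- cs) edges_of pb c| = size cs * edge_count pb k.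
Proof.
move=> hk; elim: cs => [|c cs IHs] /=; first by rewrite big_nil cards0.
rewrite cat_uniq big_cons => /and3P[uc /hasPn dis ucs].
have hc : pb = CyclePacking -> 3 <= size c by rewrite size_tuple.
rewrite cardsU IHs // card_edges_of // size_tuple mulSn.
suff -> : edges_of pb c :&: \bigcup_(c <- cs) edges_of pb c = set0.
  by rewrite cards0 subn0.
apply/eqP; rewrite -subset0; apply/subsetP=> e; rewrite !inE => /andP[ec ecs].
have [e2 sub] := edges_ofP hc uc ec.
have /set0Pn[v ve] : e != set0 by rewrite -cards_eq0 e2.
suff /dis : v \in flatten [seq tval c | c <- cs] by rewrite /= sub.
elim: cs ucs ecs {IHs dis} => [|d cs IHs]; first by rewrite big_nil inE.
rewrite big_cons inE /= cat_uniq mem_cat => /and3P[ud _ ucs] /orP[ed|].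
  by have [|_ ->] := edges_ofP _ ud ed; rewrite ?size_tuple.
by move/(IHs ucs)->; rewrite orbT.
Qed.

Lemma card_packing_edges pb k n (P : candidate k n) :
  (pb = CyclePacking -> 3 <= k) -> is_packing P ->
  #|packing_edges pb P| = (n %/ k) * edge_count pb k.
Proof. by move=> hk /andP[uP _]; rewrite card_blocks_edges ?size_tuple. Qed.

(** Makes [weighted_in] applicable, as it constrains only two-element sets. *)
Lemma packing_edges_card2 pb k n (P : candidate k n) e :
  (pb = CyclePacking -> 3 <= k) -> is_packing P ->
  e \in packing_edges pb P -> #|e| = 2.
Proof.
move=> hk /andP[uP _]; move: uP; rewrite /vertices /packing_edges.
elim: (tval P) => [|c cs IHs] /=; first by rewrite big_nil inE.
rewrite big_cons inE cat_uniq => /and3P[uc _ ucs] /orP[|]; last exact: IHs.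
by move=> ec; have [] := edges_ofP _ uc ec; rewrite ?size_tuple.
Qed.

(** * Lowering the weights by one *)

Definition lower n (w : weighting n) : weighting n := fun e => (w e).-1.

Lemma lower_weighted_in n (w : weighting n) :
  weighted_in [:: 1; 2] w -> weighted_in [:: 0; 1] (lower w).
Proof. by move=> hw e /hw; rewrite /lower !inE => /orP[]/eqP->. Qed.

Section Lower.

Variables (pb : problem) (k n : nat) (w : weighting n).
Hypothesis hk : pb = CyclePacking -> 3 <= k.
Hypothesis hw : weighted_in [:: 1; 2] w.

Lemma packing_weight_lower (P : candidate k n) : is_packing P ->
  packing_weight pb w P =
  packing_weight pb (lower w) P + (n %/ k) * edge_count pb k.
Proof.
move=> packP; rewrite -(card_packing_edges hk packP) -sum1_card -big_split /=.
apply: eq_bigr => e /(packing_edges_card2 hk packP)/hw; rewrite /lower !inE.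
by case/orP=> /eqP->.
Qed.

Lemma opt_lower : opt pb k w <= opt pb k (lower w) + (n %/ k) * edge_count pb k.
Proof.
apply/bigmax_leqP=> P packP; rewrite packing_weight_lower // leq_add2r.
exact: leq_bigmax_cond.
Qed.

Lemma opt_lower_le : opt pb k (lower w) <= (n %/ k) * edge_count pb k.
Proof.
apply/bigmax_leqP=> P packP; rewrite -(card_packing_edges hk packP) -sum1_card.
apply: leq_sum => e /(packing_edges_card2 hk packP)/hw; rewrite /lower !inE.
by case/orP=> /eqP->.
Qed.

Lemma approx_lower (R : realType) (rho : R) (P : candidate k n) :
  (0 <= rho <= 1)%R -> is_packing P ->
  (rho * (opt pb k (lower w))%:R <= (packing_weight pb (lower w) P)%:R)%R ->
  ((1 + rho) / 2%:R * (opt pb k w)%:R <= (packing_weight pb w P)%:R)%R.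
Proof.
move=> /andP[rho0 rho1] packP; rewrite packing_weight_lower // natrD.
have := opt_lower; rewrite -(ler_nat R) natrD.
have := opt_lower_le; rewrite -(ler_nat R).
move: (opt _ _ w)%:R%R (opt _ _ _)%:R%R (packing_weight _ _ _)%:R%R => o' o p.
(* The slack is [(p - rho * o) + (1 + rho) / 2 * (o + m - o') + (1 - rho) / 2 * (m - o)], a sum of
   nonnegative terms. *)
move: (_ * _)%N%:R%R => m om o'om ap; nra.
Qed.

End Lower.

Definition lower_symbol (s : symbol) : symbol :=
  match s with D1 => D0 | D2 => D1 | _ => s end.

Lemma encode_graph_lower n (w : weighting n) : weighted_in [:: 1; 2] w ->
  encode_graph (lower w) = map lower_symbol (encode_graph w).
Proof.
move=> hw; rewrite /encode_graph map_flatten -map_comp; congr flatten.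
apply: eq_map => u /=; rewrite map_rcons -map_comp; congr rcons.
apply: eq_map => v /=; case: (eqVneq u v) => //= uv; rewrite /lower.
by have := hw [set u; v]; rewrite cards2 uv !inE => /(_ erefl)/orP[]/eqP->.
Qed.

(** * Machines that preprocess their input symbol by symbol *)

Section Relabel.

Variables (f : symbol -> symbol) (M : machine).

(* In state [inl true] the machine sweeps right and rewrites the input, in state
   [inl false] it returns to the left end, and in [inr q] it simulates [M]. *)
Definition relabel_delta (q : bool + state M) (a : cell M) :
    option ((bool + state M) * cell M * move) :=
  match q, a with
  | inl true, Some (inl s) => Some (inl true, Some (inl (f s)), MoveR)
  | inl true, None => Some (inl false, None, MoveL)
  | inl true, Some (inr _) => None
  | inl false, Some _ => Some (inl false, a, MoveL)
  | inl false, None => Some (inr (start M), None, MoveR)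
  | inr q, _ => omap (fun x => (inr x.1.1, x.1.2, x.2)) (delta q a)
  end.

Definition relabel_input : machine :=
  @Machine (bool + state M)%type (aux M) (inl true) relabel_delta.

(* Tapes are compared pointwise, which avoids functional extensionality. *)
Definition config_is (M' : machine) (c : config M') q t h : Prop :=
  [/\ cstate c = q, tape c =1 t & head_pos c = h].

(** The new tape [t'] is free up to pointwise equality, so it can be given directly in the form of
    the next invariant. *)
Lemma config_is_step M' (c : config M') q t h q' a m t' h' :
  config_is c q t h -> delta q (t h) = Some (q', a, m) ->
  t' =1 (fun z => if z == h then a else t z) -> h' = (h + shift m)%R ->
  config_is (step c) q' t' h'.
Proof.
case: c => cq ct ch [/= -> et ->] ed et' ->.
rewrite /step /action /= et ed; split=> //= z.
by rewrite et' et.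
Qed.

Let word_tape x : int -> cell relabel_input := tape (init relabel_input x).

Lemma word_tape_update s1 s2 a b :
  word_tape (s1 ++ b :: s2) =1
  (fun z => if z == size s1 then Some (inl b) else word_tape (s1 ++ a :: s2) z).
Proof.
case=> i //; rewrite /word_tape /= /word_cell !onth_cat eqz_nat.
case: (ltngtP i (size s1)) => [//|lt|->]; last by rewrite subnn.
(* Right of the written cell, [i - size s1] is a successor, so both lookups fall into [s2]. *)
by rewrite -(ltn_predK (_ : 0 < i - size s1)) ?subn_gt0.
Qed.

(** Sweep invariant: [s1] is already rewritten, [s2] is still untouched, and the head stands at
    their border. *)
Lemma relabel_sweep s1 s2 (c : config relabel_input) :
  config_is c (inl true) (word_tape (s1 ++ s2)) (size s1) ->
  config_is (iter (size s2) (@step _) c) (inl true)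
    (word_tape (s1 ++ map f s2)) (size (s1 ++ s2)).
Proof.
elim: s2 s1 c => [|a s2 IHs] s1 c; first by rewrite !cats0.
move=> hc; rewrite [size (a :: _)]/= iterSr /= -!cat_rcons.
rewrite (_ : size (rcons s1 a ++ s2) = size (rcons s1 (f a) ++ s2)); last first.
  by rewrite !size_cat !size_rcons.
apply: IHs; apply: (config_is_step hc).
- by rewrite /word_tape /= /word_cell onth_cat ltnn subnn.
- by rewrite cat_rcons; exact: word_tape_update.
- by rewrite size_rcons /=; lia.
Qed.

(** The bound on [i] keeps the cells crossed nonblank until the head reaches position -1, the blank
    where it turns around; this turn is the extra step. *)
Lemma relabel_return y i (c : config relabel_input) : i <= size y ->
  config_is c (inl false) (word_tape y) (i%:Z - 1)%R ->
  config_is (iter i.+1 (@step _) c) (inr (start M)) (word_tape y) 0%R.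
Proof.
elim: i c => [|i IHi] c hi hc.
  apply: (config_is_step hc); rewrite //.
  by move=> z; case: eqP => [->|].
rewrite iterSr; apply: IHi; first exact: ltnW.
have ei : (i.+1%:Z - 1 = i%:Z)%R by lia.
rewrite ei in hc; have : onth y i by rewrite onthTE.
case ey: (onth y i) => [a|] // _.
apply: (config_is_step hc (a := Some (inl a)) (m := MoveL)) => //.
- by rewrite /word_tape /= /word_cell ey.
- by move=> z; case: eqP => // ->; rewrite /word_tape /= /word_cell ey.
Qed.

(** Both machines have the same tape alphabet, so their tapes are compared without translation. *)
Definition simulates (c' : config relabel_input) (c : config M) : Prop :=
  config_is c' (inr (cstate c)) (tape c) (head_pos c).

(** Sweep and return each take [size x] steps plus one for the turn at the blank. *)
Lemma relabel_init x :
  simulates (iter (2 * (size x).+1) (@step _) (init relabel_input x))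
            (init M (map f x)).
Proof.
have h1 := @relabel_sweep [::] x (init relabel_input x).
have {}h1 := h1 (And3 erefl (fun=> erefl) erefl).
rewrite /= in h1.
have h2 : config_is (iter (size x).+1 (@step _) (init relabel_input x))
    (inl false) (word_tape (map f x)) ((size x)%:Z - 1)%R.
  have blank : word_tape (map f x) (size x) = None.
    by rewrite /word_tape /= /word_cell onth_default ?size_map.
  apply: (config_is_step h1 (a := None) (m := MoveL)) => //=.
    by rewrite blank.
  by move=> z; case: eqP => // ->.
have := @relabel_return (map f x) (size x) _ _ h2.
by rewrite -iterD mulSn mul1n size_map => /(_ (leqnn _)).
Qed.

(** As [omap] preserves [None], the two machines halt together. *)
Lemma simulates_action c' c : simulates c' c ->
  action c' = omap (fun x => (inr x.1.1, x.1.2, x.2)) (action c).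
Proof. by case: c' => q t h [/= eq et eh]; rewrite /action /= eq et eh. Qed.

Lemma simulates_step c' c : simulates c' c -> simulates (step c') (step c).
Proof.
move=> sim; have := simulates_action sim; case: sim => eq et eh.
rewrite /step; case: (action c) => [[[q a] m]|] -> //=.
by split=> //= [z|]; rewrite eh // et.
Qed.

Lemma simulates_iter t c' c : simulates c' c ->
  simulates (iter t (@step _) c') (iter t (@step _) c).
Proof. by move=> sim; elim: t => //= t; exact: simulates_step. Qed.

Lemma relabel_outputs x t y : outputs_within M (map f x) t y ->
  outputs_within relabel_input x (t + 2 * (size x).+1) y.
Proof.
rewrite /outputs_within iterD => -[halt out].
have sim := simulates_iter t (relabel_init x); split.
  by rewrite (simulates_action sim) halt.
by case: sim => _ et eh i /out; rewrite et eh.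
Qed.

End Relabel.

Lemma polytime_approx_lower (R : realType) pb k (rho : R) (M : machine) :
  (0 <= rho <= 1)%R -> (pb = CyclePacking -> 3 <= k) ->
  polytime_approx pb k [:: 0; 1] rho M ->
  polytime_approx pb k [:: 1; 2] ((1 + rho) / 2%:R)%R
    (relabel_input lower_symbol M).
Proof.
(* Relabelling preserves the input length, so [p] still bounds the simulated run; [('X + 1) *+ 2]
   pays for the preprocessing. *)
move=> hrho hk [p hp]; exists (p + ('X + 1) *+ 2)%R => n w kn hw.
have [P [out packP ap]] := hp n _ kn (lower_weighted_in hw).
exists P; split=> //; last exact: approx_lower.
rewrite encode_graph_lower // size_map in out.
have := relabel_outputs out; congr outputs_within.
by rewrite hornerD hornerMn hornerD hornerX hornerC; lia.
Qed.

Theorem mainTheorem11 (R : realType) (k : nat) (rho : R)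
    (hrho : (0 <= rho <= 1)%R) :
  (3 <= k ->
   (exists M : machine, polytime_approx CyclePacking k [:: 0; 1] rho M) ->
   exists M : machine,
     polytime_approx CyclePacking k [:: 1; 2] ((1 + rho) / 2%:R)%R M)
  /\
  (1 <= k ->
   (exists M : machine, polytime_approx PathPacking k [:: 0; 1] rho M) ->
   exists M : machine,
     polytime_approx PathPacking k [:: 1; 2] ((1 + rho) / 2%:R)%R M).
Proof.
by split=> hk [M hM]; exists (relabel_input lower_symbol M);
  apply: polytime_approx_lower.
Qed.
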